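(* Let $X$ be an unbounded proper metric space of bounded geometry. Then $X$ has property A if and only if $X$ has property A$'$.
   Context: Let $(X,d)$ be a metric space; $B(x,r)$ and $B[x,r]$ denote open and closed balls. $X$ is proper if closed balls are compact. $X$ has bounded geometry if there is $\varepsilon>0$ such that for all $r>0$ there is $N_r\in\mathbb{N}$ such that for all $x\in X$ the ball $B(x,r)$ can be covered by at most $N_r$ open balls of radius $\varepsilon$. For a Banach space $Y$ and $R,\varepsilon>0$, a map $\xi\colon X\to Y$ has $(R,\varepsilon)$-variation if $\|\xi(x)-\xi(y)\|\le\varepsilon$ for all $x,y\in X$ with $d(x,y)\le R$. Property A (for $X$ proper of bounded geometry): for all $R,\varepsilon>0$ there exists a weak$^*$-continuous map $\mu\colon X\to C_0(X)^*=\mathcal{M}(X)$, $x\mapsto\mu_x$ (the regular countably additive complex Borel measures on $X$, with total variation norm), such that (a) $\|\mu_x\|=1$ for all $x\in X$; (b) $\mu$ has $(R,\varepsilon)$-variation; (c) there exists $S>0$ such that for all $x\in X$ the measure $\mu_x$ is supported in $B[x,S]$. Property A$'$ (for $X$ proper of bounded geometry): for every $t>0$ there is a countably infinite collection $(\varrho_{j,t})_{j\in\mathbb{N}}$ of non-zero measurable functions $\varrho_{j,t}\colon X\to[0,1]$ such that (i) $\sum_{j\in\mathbb{N}}\varrho_{j,t}(x)=1$ for all $x\in X$; (ii) $\sup_{j}\operatorname{diam}(\operatorname{spt}\varrho_{j,t})<\infty$, where $\operatorname{spt}$ denotes the support; (iii) $d(x,y)\le\frac1t$ implies $\sum_{j\in\mathbb{N}}|\varrho_{j,t}(x)-\varrho_{j,t}(y)|<t$;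 (iv) for all $x\in X$ and $s>0$ the set $\{j\in\mathbb{N}:\operatorname{spt}\varrho_{j,t}\cap B(x,s)\neq\varnothing\}$ is finite. *)

(* Defs.v *)
(* MathComp-Analysis, with complex numbers from mathcomp-real-closed. *)
From HB Require Import structures.
From mathcomp Require Import all_boot all_order all_algebra.
From mathcomp Require Import complex.
From mathcomp Require Import all_classical all_reals all_analysis.

Set Implicit Arguments.
Unset Strict Implicit.
Unset Printing Implicit Defensive.

Import Order.TTheory GRing.Theory Num.Theory.
Import numFieldNormedType.Exports.

Local Open Scope classical_set_scope.
Local Open Scope ring_scope.
Local Open Scope complex_scope.

(* The sigma-algebras of the library live on pointed types, hence metric spaces
   with a distinguished point.  The point plays no role in the definitions
   below; an unbounded space is nonempty, so nothing is lost. *)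
#[short(type="pmetricType")]
HB.structure Definition PointedMetric (K : numDomainType) :=
  {M of Pointed M & Metric K M}.

Section metric_notions.
Context {R : realType} (X : pmetricType R).

(* [closed_ball] of the library is the closure of the open ball, which may be
   strictly smaller. *)
Definition cball (x : X) (r : R) : set X := [set y | mdist x y <= r].

Definition proper_space := forall (x : X) (r : R), compact (cball x r).

Definition unbounded_space := ~ exists r : R, forall x y : X, mdist x y <= r.

Definition bounded_geometry :=
  exists2 eps : R, 0 < eps & forall r : R, 0 < r ->
    exists N : nat, forall x : X,
      exists s : seq X, (size s <= N)%N /\
        ball x r `<=` \bigcup_(c in [set` s]) ball c eps.

(* Equal to -oo on the empty set. *)
Definition diam (A : set X) : \bar R :=
  ereal_sup [set (mdist p.1 p.2)%:E | p in A `*` A].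

Definition spt (f : X -> R) : set X := closure [set x | f x != 0].

(* The norm of the target is a parameter with values in \bar R: the total
   variation norm below is defined on all complex-valued set functions and is finite
   on measures. *)
Definition has_variation (Y : zmodType) (norm : Y -> \bar R) (xi : X -> Y)
    (r eps : R) :=
  forall x y : X, mdist x y <= r -> (norm (xi x - xi y)%R <= eps%:E)%E.

End metric_notions.

Local Notation normc := ComplexField.Normc.normc.

Notation borel X := (g_sigma_algebraType (@open X)).

Section complex_measures.
Context {R : realType} (X : pmetricType R).

(* A countably additive complex measure is given by its real and imaginary
   parts, which are finite countably additive signed measures. *)
Record complex_measure := ComplexMeasure {
  cm_re : {charge set (borel X) -> \bar R} ;
  cm_im : {charge set (borel X) -> \bar R} }.

Definition cm_val (mu : complex_measure) (A : set (borel X)) : R[i] :=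
  fine (cm_re mu A) +i* fine (cm_im mu A).

(* [abs_variation (cm_val mu) A] is |mu|(A). *)
Definition abs_variation (m : set (borel X) -> R[i]) (A : set (borel X)) :
    \bar R :=
  ereal_sup [set (\sum_(0 <= i <oo) (normc (m (E i)))%:E)%E |
    E in [set E : (set (borel X))^nat |
      [/\ forall i, measurable (E i), trivIset setT E & \bigcup_i E i = A]]].

Definition tv_norm (m : set (borel X) -> R[i]) : \bar R :=
  abs_variation m setT.

Definition regular_measure (mu : complex_measure) :=
  let v := abs_variation (cm_val mu) in
  forall A : set (borel X), measurable A ->
    v A = ereal_inf [set v U | U in [set U : set X | open U /\ A `<=` U]] /\
    v A = ereal_sup [set v K | K in [set K : set X | compact K /\ K `<=` A]].

Definition supported_in (mu : complex_measure) (A : set X) :=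
  abs_variation (cm_val mu) (~` A) = 0%E.

(* The Hahn decomposition is chosen, but the measures [jordan_pos] and
   [jordan_neg] do not depend on the choice. *)
Lemma Hahn_pair (nu : {charge set (borel X) -> \bar R}) :
  exists PN, hahn_decomposition nu PN.1 PN.2.
Proof. by have [P [N PN]] := Hahn_decomposition nu; exists (P, N). Qed.

Definition charge_integral (nu : {charge set (borel X) -> \bar R})
    (f : X -> R) : R :=
  let PN := svalP (cid (Hahn_pair nu)) in
  (\int[jordan_pos PN]_x f x - \int[jordan_neg PN]_x f x)%R.

Definition cm_integral (mu : complex_measure) (f : X -> R[i]) : R[i] :=
  let u := fun x => complex.Re (f x) in
  let v := fun x => complex.Im (f x) in
  (charge_integral (cm_re mu) u - charge_integral (cm_im mu) v) +i*
  (charge_integral (cm_re mu) v + charge_integral (cm_im mu) u).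

Definition C0 (f : X -> R[i]) :=
  continuous (f : X -> R[i]^o) /\
  forall eps : R, 0 < eps ->
    exists2 K : set X, compact K & forall x, ~ K x -> normc (f x) < eps.

(* Continuity of x |-> mu_x for the topology of pointwise convergence on C0. *)
Definition weak_star_continuous (mu : X -> complex_measure) :=
  forall f : X -> R[i], C0 f ->
    continuous ((fun x => cm_integral (mu x) f) : X -> R[i]^o).

End complex_measures.

Definition property_A (R : realType) (X : pmetricType R) :=
  forall r eps : R, 0 < r -> 0 < eps ->
  exists mu : X -> complex_measure X,
    [/\ forall x, regular_measure (mu x),
        weak_star_continuous mu,
        forall x, tv_norm (cm_val (mu x)) = 1%E,
        has_variation (@tv_norm R X) (fun x => cm_val (mu x)) r eps &
        exists2 S : R, 0 < S & forall x, supported_in (mu x) (cball x S)].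

Definition property_A' (R : realType) (X : pmetricType R) :=
  forall t : R, 0 < t ->
  exists rho : nat -> X -> R,
    [/\ forall j, exists x, rho j x != 0,
        forall j, measurable_fun [set: borel X] (rho j : borel X -> R) &
        forall j x, 0 <= rho j x <= 1] /\
    [/\ forall x, (\sum_(0 <= j <oo) (rho j x)%:E = 1)%E,
        (ereal_sup (range (fun j => diam (spt (rho j)))) < +oo)%E,
        forall x y, mdist x y <= 1 / t ->
          (\sum_(0 <= j <oo) `|rho j x - rho j y|%:E < t%:E)%E &
        forall (x : X) (s : R), 0 < s ->
          finite_set [set j | spt (rho j) `&` ball x s !=set0]].

(* Main.v *)
Require Import Defs.
From HB Require Import structures.
From mathcomp Require Import all_boot all_order all_algebra.
From mathcomp Require Import complex finmap.
From mathcomp Require Import all_classical all_reals all_analysis.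
From mathcomp Require Import measurable_realfun.
From mathcomp Require Import ring lra.

Set Implicit Arguments.
Unset Strict Implicit.
Unset Printing Implicit Defensive.

Import Order.TTheory GRing.Theory Num.Theory.
Import numFieldNormedType.Exports.

Local Open Scope classical_set_scope.
Local Open Scope ring_scope.
Local Open Scope complex_scope.

(**
Both properties are compared with a discrete one.  Fix a sequence [a] in [X]
that is 1-separated, 1-dense and locally finite.  Such a sequence exists because
a maximal 1-separated set meets every closed ball, which is compact, in a finite
set, and because a finite 1-dense set would make [X] bounded.  An averaging
kernel attaches to each index [i] a finitely supported probability vector
[w i] on a set of points [p j], with [p j] uniformly close to [a i] whenever
[w i j] is nonzero, and with [w i] and [w k] close in l^1 whenever [a i] and
[a k] are close.  Each of the two properties is equivalent to the existence of
averaging kernels for all parameters, and both equivalences use one principle: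
a function may be sampled on the net and extended from the net to [X], and
such a round trip enlarges the distances at which the variation is controlled by
at most 2, which is harmless because both properties are required at every scale.

From measures to kernels ([kernels_of_property_A]): the net gives a Borel
partition of [X] into cells of bounded diameter, and [w i j] is the mass that
[mu (a i)] gives to cell [j].  As mass of a complex measure one takes the sum of
the Jordan variations of its real and imaginary part: it is countably additive,
its total lies above the total variation, and the masses of two measures differ,
summed over all cells, by at most twice the total variation of the difference
([charge_tv_cells_dist]).  A small multiple of the unit vector at [i] is added
before normalising, so that every diagonal entry is nonzero.

From kernels to partitions ([property_A'_of_kernels]): [rho j] is constant equal
to [w i j] on cell [i]; it is nonzero because it is nonzero at [a j].

From partitions to kernels ([kernels_of_property_A']): [w i j] is
[rho j (a i)], and [p j] is any point where [rho j] is nonzero.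

From kernels to measures ([property_A_of_kernels]): with a locally finite
continuous partition of unity [phi] subordinate to the unit balls of the net,
[mu x] is the average, with weights [phi i x], of the discrete measures with
masses [w i j] at [p j].  Locally in [x] this is a fixed finite combination of
point masses with continuous coefficients, hence weak* continuous; finitely
supported measures are regular; and the difference of two such averages is an
average of differences [w i - w k] with [a i] and [a k] close.
*)

Local Notation normc := ComplexField.Normc.normc.
Local Notation borel X := (g_sigma_algebraType (@open X)).

(** * Balls and Borel sets of a metric space *)
Section metric_topology.
Context {R : realType} {X : pmetricType R}.
Implicit Types (x y c : X) (r : R).

Lemma mdist_ball_open x r : open (ball x r).
Proof.
rewrite openE => y; rewrite ballEmdist /= => xy.
apply/nbhs_ballP; exists (r - mdist x y); first by rewrite /= subr_gt0.
move=> z; rewrite !ballEmdist /= => yz.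
by have := metric_triangle x y z; lra.
Qed.

Lemma mdist_continuous c : continuous (fun x : X => mdist c x).
Proof.
move=> x; apply/cvgrPdist_lt => e e0.
apply/nbhs_ballP; exists e => //= z; rewrite ballEmdist /= => xz.
rewrite ltr_norml; apply/andP; split.
  by have := metric_triangle c x z; lra.
by have := metric_triangle c z x; rewrite (metric_sym z x); lra.
Qed.

Lemma cball_closed x r : closed (cball x r).
Proof.
have -> : cball x r = mdist x @^-1` [set t | t <= r] by [].
by apply: closed_comp; [move=> y _; exact: mdist_continuous|exact: closed_le].
Qed.

Lemma open_borel (U : set X) : open U -> measurable (U : set (borel X)).
Proof. exact: sub_sigma_algebra. Qed.

Lemma closed_borel (C : set X) : closed C -> measurable (C : set (borel X)).
Proof.
move=> cC; rewrite -[C]setCK; apply: measurableC; apply: sub_sigma_algebra.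
exact: closed_openC.
Qed.

End metric_topology.

Lemma finite_nat_bounded (A : set nat) :
  finite_set A -> exists N, forall i, A i -> (i < N)%N.
Proof.
move=> /finite_fsetP[F ->]; exists (\max_(i <- F) i).+1 => i /= iF.
by rewrite ltnS; apply: (@leq_bigmax_seq _ _ xpredT id).
Qed.

(** * Locally finite nets in proper unbounded spaces *)
Section nets.
Context {R : realType} {X : pmetricType R}.

Definition one_separated (D : set X) :=
  forall x y, D x -> D y -> x <> y -> 1 <= mdist x y.

(** A maximal 1-separated set is 1-dense: a point at distance at least 1 from
    all of its elements could be added to it. *)
Lemma maximal_separated_set :
  exists2 D : set X, one_separated D & forall x, exists2 a, D a & mdist a x < 1.
Proof.
have [F Fsep Ftot|D [sepD maxD]] := @Zorn_bigcup X one_separated.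
  move=> x y [A FA Ax] [B FB By].
  have [AB|BA] := Ftot _ _ FA FB; first exact: (Fsep B) (AB _ Ax) By.
  exact: (Fsep A) Ax (BA _ By).
exists D => // x; apply: contrapT => farx.
have far a : D a -> 1 <= mdist a x.
  by move=> Da; rewrite leNgt; apply/negP => ax; apply: farx; exists a.
apply: (maxD (D `|` [set x])).
  split; first by move=> y; left.
  move=> /(_ x (or_intror erefl)) Dx; have := far _ Dx.
  by rewrite mdistxx ler10.
move=> y z [Dy|->] [Dz|->] // yz; first exact: sepD.
- exact: far.
- by rewrite metric_sym; exact: far.
Qed.

(** Cover the compact ball by finitely many balls of radius 1/2: each of them
    contains at most one point of a 1-separated set. *)
Lemma separated_cball_finite (D : set X) (x : X) (r : R) :
  proper_space X -> one_separated D -> finite_set (D `&` cball x r).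
Proof.
move=> properX sepD; have := properX x r; rewrite compact_cover => coverK.
have [c _||F _ coverF] := coverK X setT (fun c => ball c 2^-1).
- exact: mdist_ball_open.
- by move=> y _; exists y => //; apply: ballxx; rewrite invr_gt0.
apply: (@sub_finite_set _ _ (\bigcup_(c in [set` F]) (D `&` ball c 2^-1))).
  by move=> y [Dy /coverF[c Fc cy]]; exists c.
apply: bigcup_finite => // c _.
have [->//|/set0P[a [Da ca]]] := eqVneq (D `&` ball c 2^-1) set0.
apply: (@sub_finite_set _ _ [set a]) => // b [Db cb].
apply: contrapT => /(sepD _ _ Db Da); move: ca cb; rewrite !ballEmdist /=.
by have := metric_triangle b c a; rewrite (metric_sym b c); lra.
Qed.

(** Enumeration of a maximal 1-separated set.  It is countable as a union of its
    traces on balls, and infinite because [X] would be bounded otherwise; local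
    finiteness takes the form of the distances to a fixed point exceeding any
    bound from some index on. *)
Lemma exists_net : proper_space X -> unbounded_space X ->
  exists a : nat -> X, [/\ forall i j, i <> j -> 1 <= mdist (a i) (a j),
    forall x, exists i, mdist (a i) x < 1 &
    forall x r, exists N, forall i, (N <= i)%N -> r < mdist (a i) x].
Proof.
move=> properX unbX; have [D sepD netD] := maximal_separated_set.
have finD x r : finite_set (D `&` cball x r) by exact: separated_cball_finite.
have cntD : countable D.
  apply: (@sub_countable _ _ _
    (\bigcup_(n in [set: nat]) (D `&` cball point n%:R))).
    apply/subset_card_le => x Dx; exists (Num.truncn (mdist point x)).+1 => //.
    split => //=; apply: ltW; exact: truncnS_gt.
  by apply: bigcup_countable => // n _; exact: finite_set_countable.
have infD : infinite_set D.
  move=> /finite_fsetP[F DF]; apply: unbX.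
  (* Every point is within 1 of some [c] in [F]; summing over all of [F] bounds
     its distance to the base point whichever [c] that is. *)
  exists (\sum_(c <- F) (2 * (mdist point c + 1))) => x y.
  have bnd (z : X) : mdist point z <= \sum_(c <- F) (mdist point c + 1).
    have [c Dc cz] := netD z.
    have Fc : c \in F by move: Dc; rewrite DF.
    rewrite (big_fsetD1 c)//=.
    apply: (@le_trans _ _ (mdist point c + 1)).
      by have := metric_triangle point c z; lra.
    by rewrite lerDl sumr_ge0 // => d _; rewrite addr_ge0 ?mdist_ge0.
  rewrite -mulr_sumr; have := metric_triangle x point y.
  by rewrite (metric_sym x point); have := bnd x; have := bnd y; lra.
have /card_esym/card_set_bijP[a [aD inja surja]] := eq_card_nat cntD infD.
exists a; split=> [i j ij|x|x r].
- by apply: sepD; [exact: aD..|move=> /inja; rewrite !inE => /(_ I I)].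
- by have [c /surja[i _ <-] cx] := netD x; exists i.
have [|N ltN] := @finite_nat_bounded (a @^-1` (D `&` cball x r)).
  by apply: finite_preimage (finD x r) => i j _ _; apply: inja; rewrite inE.
exists N => i; rewrite leqNgt ltNge; apply: contra => aix; apply: ltN.
by split; [exact: aD|rewrite /cball /= metric_sym].
Qed.

End nets.

(** * Sums of sequences with finite support *)
Section finite_sums.
Context {R : realType}.
Implicit Types f : nat -> R.

Lemma sum_zero_tail f m n :
  (forall i, (m <= i)%N -> f i = 0) -> (m <= n)%N ->
  \sum_(i < n) f i = \sum_(i < m) f i.
Proof.
move=> f0 mn; rewrite -!(big_mkord xpredT f) (big_cat_nat (leq0n m) mn) /=.
by rewrite [X in _ + X]big_nat [X in _ + X]big1 ?addr0 // => i /andP[/f0].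
Qed.

Lemma eq_sum_zero_tail f m n :
  (forall i, (m <= i)%N -> f i = 0) -> (forall i, (n <= i)%N -> f i = 0) ->
  \sum_(i < m) f i = \sum_(i < n) f i.
Proof.
move=> fm fn; case/orP: (leq_total m n) => mn.
  by rewrite (sum_zero_tail fm mn).
by rewrite (sum_zero_tail fn mn).
Qed.

Lemma eseries_zero_tail f n : (forall i, (n <= i)%N -> f i = 0) ->
  (\sum_(0 <= i <oo) (f i)%:E = (\sum_(i < n) f i)%:E)%E.
Proof.
move=> f0; apply/cvg_lim => //; apply: cvg_near_cst.
exists n => // m /= nm.
by rewrite sumEFin big_mkord (sum_zero_tail f0 nm).
Qed.

End finite_sums.

(** * A Borel partition into cells around a net *)
Section cells.
Context {R : realType} {X : pmetricType R}.

(** The cell of [x] is given by the first net point within distance 1 of [x];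
    each cell is thus an open ball minus finitely many open balls.  For a
    1-separated net, [a j] lies in the cell [j] since no other net point is
    within distance less than 1 of it. *)
Lemma exists_cells (a : nat -> X) : (forall x, exists i, mdist (a i) x < 1) ->
  exists idx : X -> nat, [/\ forall x, mdist (a (idx x)) x < 1,
    (forall i j, i <> j -> 1 <= mdist (a i) (a j)) -> forall j, idx (a j) = j &
    forall B : set nat, measurable (idx @^-1` B : set (borel X))].
Proof.
move=> cover; exists (fun x => ex_minn (cover x)); split=> [x|sepa j|B].
- by case: ex_minnP.
- case: ex_minnP => i aij _; apply: contrapT => /(sepa i j).
  by rewrite leNgt aij.
- have -> : (fun x => ex_minn (cover x)) @^-1` B = \bigcup_(i in B)
      (ball (a i) 1 `\` \bigcup_(k in `I_i) ball (a k) 1).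
    apply/seteqP; split=> x /=.
      case: ex_minnP => i aix mini Bi; exists i => //; split.
        by rewrite ballEmdist.
      move=> [k /= ki]; rewrite ballEmdist /= => /mini.
      by rewrite leqNgt ki.
    move=> [i Bi []]; rewrite ballEmdist /= => aix nk.
    case: ex_minnP => k akx mink.
    have [ki|ik|-> //] := ltngtP k i.
      by exfalso; apply: nk; exists k => //; rewrite ballEmdist.
    by have := mink _ aix; rewrite leqNgt ik.
  have mball (i : nat) : measurable (ball (a i) 1 : set (borel X)).
    by apply: open_borel; exact: mdist_ball_open.
  apply: bigcup_measurable => i _; apply: measurableD => //.
  exact: bigcup_measurable.
Qed.

End cells.

(** * Averaging kernels, and from kernels to partitions *)
Section kernels.
Context {R : realType} {X : pmetricType R}.

(** A discrete form of property A: [w i] is a finitely supported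
    probability vector at [a i], charging only the points [p j] near [a i].  The
    points [p] may differ from the net [a]; the l^1 bound is stated through
    partial sums to avoid infinite series. *)
Definition averaging_kernel (a p : nat -> X) (r eps : R)
    (w : nat -> nat -> R) :=
  [/\ forall i j, 0 <= w i j,
      forall i, exists2 n, forall j, (n <= j)%N -> w i j = 0 &
        \sum_(j < n) w i j = 1,
      exists S, forall i j, w i j != 0 -> mdist (a i) (p j) <= S &
      forall i k, mdist (a i) (a k) <= r ->
        forall N, \sum_(j < N) `|w i j - w k j| <= eps].

(** Extend the kernel to [X] as a step function, constant on the cells.  Two
    points at distance at most 1/t lie in cells whose centres are at distance at
    most 1/t + 2, which is why the kernel is taken at that scale.  The nonzero
    diagonal of the kernel makes every function of the partition nonzero. *)
Lemma property_A'_of_kernels (a : nat -> X) :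
  (forall i j, i <> j -> 1 <= mdist (a i) (a j)) ->
  (forall x, exists i, mdist (a i) x < 1) ->
  (forall x r, exists N, forall i, (N <= i)%N -> r < mdist (a i) x) ->
  (forall r eps : R, 0 < r -> 0 < eps -> exists2 w,
    averaging_kernel a a r eps w & forall j, w j j != 0) ->
  property_A' X.
Proof.
move=> sepa cover lfin kernels t t0.
have [idx [idx_near idxa midx]] := exists_cells cover.
have r0 : 0 < 1 / t + 2 by rewrite addr_gt0 // divr_gt0.
have t20 : 0 < t / 2 by rewrite divr_gt0.
have [w [w0 wsum [S wS] wvar] wdiag] := kernels _ _ r0 t20.
have w1 i j : w i j <= 1.
  have [n wn <-] := wsum i; case: (ltnP j n) => [jn|/wn ->].
    by rewrite (bigD1 (Ordinal jn)) //= lerDl sumr_ge0.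
  by rewrite sumr_ge0.
have sptw j : spt (fun x => w (idx x) j) `<=` cball (a j) (S + 1).
  rewrite [cball _ _](closure_id _).1; last exact: cball_closed.
  apply: closure_subset => x /= /wS; rewrite /cball /=.
  have := idx_near x; have := metric_triangle (a j) (a (idx x)) x.
  by rewrite (metric_sym (a j) (a (idx x))); lra.
exists (fun j x => w (idx x) j); split; split.
- by move=> j; exists (a j); rewrite idxa.
- by move=> j _ B mB; rewrite setTI; exact: (midx [set i | B (w i j)]).
- by move=> j x; rewrite w0 w1.
- move=> x; have [n wn sum1] := wsum (idx x).
  by rewrite (eseries_zero_tail wn) sum1.
- apply: (@le_lt_trans _ _ (2 * (S + 1))%:E); last exact: ltry.
  apply: ge_ereal_sup => _ [j _ <-]; apply: ge_ereal_sup.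
  move=> _ [[x y] /= [/sptw ax /sptw ay] <-]; move: ax ay.
  rewrite /cball /= lee_fin => ax ay.
  by have := metric_triangle x (a j) y; rewrite (metric_sym x (a j)); lra.
- move=> x y xy; have [n wn _] := wsum (idx x); have [m wm _] := wsum (idx y).
  rewrite (@eseries_zero_tail _ (fun j => `|w (idx x) j - w (idx y) j|)
    (maxn n m)); last first.
    by move=> j; rewrite geq_max => /andP[/wn -> /wm ->]; rewrite subrr normr0.
  rewrite lte_fin; apply: (@le_lt_trans _ _ (t / 2)); last by lra.
  apply: wvar.
  have := metric_triangle (a (idx x)) x (a (idx y)).
  have := metric_triangle x y (a (idx y)).
  have := idx_near x; have := idx_near y; rewrite (metric_sym y (a (idx y))).
  by lra.
- move=> x s s0; have [N ltN] := lfin x (S + 1 + s).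
  apply: (@sub_finite_set _ _ `I_N) => // j [y [/sptw]].
  rewrite /cball ballEmdist /= => ajy xy; rewrite ltnNge; apply/negP => /ltN.
  by have := metric_triangle (a j) y x; rewrite (metric_sym y x); lra.
Qed.

End kernels.

(** * Jordan variation of a signed measure *)
Section charge_total_variation.
Context {R : realType} {X : pmetricType R}.
Implicit Types (nu : {charge set (borel X) -> \bar R}) (A Q : set (borel X)).

(** The measure |nu| of a signed measure, built from a Hahn decomposition. *)
Definition charge_tv nu : set (borel X) -> \bar R :=
  charge_variation (svalP (cid (Hahn_pair nu))).

Definition hahn_pos nu : set (borel X) := (sval (cid (Hahn_pair nu))).1.

Lemma measurable_hahn_pos nu : measurable (hahn_pos nu).
Proof.
by rewrite /hahn_pos; case: cid => -[P N] /= [[]].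
Qed.

Lemma charge_tv_fin nu A : measurable A -> charge_tv nu A \is a fin_num.
Proof. exact: fin_num_measure. Qed.

Lemma charge_tv_ge0 nu A : (0 <= charge_tv nu A)%E.
Proof. exact: measure_ge0. Qed.

Lemma charge_tv_bigcup nu (E : nat -> set (borel X)) :
  (forall i, measurable (E i)) -> trivIset setT E ->
  charge_tv nu (\bigcup_i E i) = (\sum_(0 <= i <oo) charge_tv nu (E i))%E.
Proof.
move=> mE tE; rewrite /charge_tv measure_bigcup //.
by apply: eq_eseriesl => i; rewrite in_setT.
Qed.

Lemma fine_chargeID nu A Q : measurable A -> measurable Q ->
  fine (nu A) = fine (nu (A `&` Q)) + fine (nu (A `\` Q)).
Proof.
move=> mA mQ.
have mAQ : measurable (A `&` Q) by exact: measurableI.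
have mAD : measurable (A `\` Q) by exact: measurableD.
rewrite -fineD; [|exact: fin_num_measure..].
by rewrite (chargeDI _ mA mQ) addeC.
Qed.

Lemma charge_tv_hahn nu A : measurable A ->
  fine (charge_tv nu A) =
  fine (nu (A `&` hahn_pos nu)) - fine (nu (A `\` hahn_pos nu)).
Proof.
move=> mA; rewrite /charge_tv /hahn_pos; case: cid => -[P N] /= PN.
rewrite /charge_variation jordan_posE jordan_negE cjordan_posE cjordan_negE.
have [[mP _] [mN _] PNT PN0] := PN.
rewrite /crestr0 mem_set// /crestr.
have -> : A `\` P = A `&` N.
  rewrite setDE; congr (A `&` _); apply/seteqP; split=> x.
    by move=> Px; have : [set: borel X] x by []; rewrite -PNT => -[].
  by move=> Nx Px; suff : (set0 : set (borel X)) x by []; rewrite -PN0.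
by rewrite fineD ?fineN // ?fin_numN fin_num_measure //; exact: measurableI.
Qed.

Lemma norm_charge_le_tv nu A : measurable A ->
  `|fine (nu A)| <= fine (charge_tv nu A).
Proof.
move=> mA; rewrite -lee_fin fineK ?charge_tv_fin//.
have := abse_charge_variation (svalP (cid (Hahn_pair nu))) mA.
by rewrite -[nu A in X in X -> _]fineK ?fin_num_measure.
Qed.

(** Among all splittings of [A] in two pieces, the Hahn decomposition
    maximises the difference of the values on the pieces. *)
Lemma charge_tv_ge nu A Q : measurable A -> measurable Q ->
  fine (nu (A `&` Q)) - fine (nu (A `\` Q)) <= fine (charge_tv nu A).
Proof.
move=> mA mQ.
have mAQ : measurable (A `&` Q) by exact: measurableI.
have mAD : measurable (A `\` Q) by exact: measurableD.
have -> : fine (charge_tv nu A) =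
    fine (charge_tv nu (A `&` Q)) + fine (charge_tv nu (A `\` Q)).
  exact: (@fine_chargeID (charge_variation (svalP (cid (Hahn_pair nu))))).
have := norm_charge_le_tv nu mAQ; have := norm_charge_le_tv nu mAD.
by rewrite !ler_norml => /andP[? ?] /andP[? ?]; lra.
Qed.

(** Split [A] along the Hahn decomposition of the measure with the larger
    variation: on that splitting the variation of one measure is attained and
    that of the other is bounded below by [charge_tv_ge]. *)
Lemma charge_tv_dist nu nu' A : measurable A ->
  exists2 Q, measurable Q &
  `|fine (charge_tv nu A) - fine (charge_tv nu' A)| <=
  `|fine (nu (A `&` Q)) - fine (nu' (A `&` Q))| +
  `|fine (nu (A `\` Q)) - fine (nu' (A `\` Q))|.
Proof.
move=> mA.
wlog le : nu nu' / fine (charge_tv nu' A) <= fine (charge_tv nu A).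
  move=> H; case/orP: (le_total (fine (charge_tv nu' A)) (fine (charge_tv nu A))).
    exact: H.
  move=> /H[Q mQ QP]; exists Q => //.
  by rewrite distrC [X in _ <= X + _]distrC [X in _ <= _ + X]distrC.
exists (hahn_pos nu); first exact: measurable_hahn_pos.
rewrite ger0_norm ?subr_ge0// charge_tv_hahn //.
have := charge_tv_ge nu' mA (measurable_hahn_pos nu).
set b := _ `&` _; set c := _ `\` _.
have := ler_norm (fine (nu b) - fine (nu' b)).
have := ler_norm (- (fine (nu c) - fine (nu' c))); rewrite normrN.
by lra.
Qed.

End charge_total_variation.

(** * Masses of cells under a complex measure *)
Section cell_masses.
Context {R : realType} {X : pmetricType R}.
Implicit Types (m : set (borel X) -> R[i]) (mu : complex_measure X).
Implicit Types nu : {charge set (borel X) -> \bar R}.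

Lemma normc_geRe (z : R[i]) : `|complex.Re z| <= normc z.
Proof.
case: z => x y /=; rewrite -sqrtr_sqr ler_wsqrtr // lerDl; exact: sqr_ge0.
Qed.

Lemma normc_geIm (z : R[i]) : `|complex.Im z| <= normc z.
Proof.
case: z => x y /=; rewrite -sqrtr_sqr ler_wsqrtr // lerDr; exact: sqr_ge0.
Qed.

Lemma normc_le (z : R[i]) : normc z <= `|complex.Re z| + `|complex.Im z|.
Proof.
case: z => x y /=.
rewrite -[leRHS]ger0_norm ?addr_ge0// -sqrtr_sqr ler_wsqrtr //.
rewrite -(real_normK (num_real x)) -(real_normK (num_real y)).
by have := mulr_ge0 (normr_ge0 x) (normr_ge0 y); nra.
Qed.

Lemma normc_ge0 (z : R[i]) : 0 <= normc z.
Proof. by case: z => x y; exact: sqrtr_ge0. Qed.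

(** The countable partition B, A minus B, empty, empty, etc. of A. *)
Lemma abs_variation_ge m (A B : set (borel X)) :
  measurable A -> measurable B -> B `<=` A ->
  ((normc (m B))%:E <= abs_variation m A)%E.
Proof.
move=> mA mB BA.
pose E (i : nat) : set (borel X) :=
  if i is i'.+1 then (if i' is 0%N then A `\` B else set0) else B.
apply: (@le_trans _ _ (\sum_(0 <= i <oo) (normc (m (E i)))%:E)%E); last first.
  apply: ereal_sup_ubound; exists E => //; split.
  - by case=> [|[|i]] //=; exact: measurableD.
  - apply/trivIsetP => -[|[|i]] [|[|j]] //= _ _ _; rewrite ?setI0 ?set0I //.
      by rewrite setDIK.
    by rewrite setIC setDIK.
  - apply/seteqP; split=> [x [[|[|i]] _ //=]|x Ax]; [exact: BA|by case|].
    by have [Bx|Bx] := pselect (B x); [exists 0%N|exists 1%N].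
have := @nneseries_lim_ge _ (fun i => (normc (m (E i)))%:E) xpredT 0 1.
rewrite big_nat1; apply => i _ _; rewrite lee_fin; exact: normc_ge0.
Qed.

Variable idx : X -> nat.
Hypothesis midx : forall B : set nat, measurable (idx @^-1` B : set (borel X)).
Let cell j : set (borel X) := idx @^-1` [set j].

(** Each cell [j] may be cut along its own set [Q j]: the halves of all cells
    still form one countable partition of the space, in which the two halves of
    cell [j] receive the indices [2 * j] and [2 * j + 1]. *)
Lemma tv_norm_split_cells m (Q : nat -> set (borel X)) N :
  (forall j, measurable (Q j)) ->
  ((\sum_(j < N) (normc (m (cell j `&` Q j)) +
                  normc (m (cell j `\` Q j))))%:E <= tv_norm m)%E.
Proof.
move=> mQ.
pose E i : set (borel X) :=
  cell i./2 `&` (if odd i then ~` Q i./2 else Q i./2).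
apply: (@le_trans _ _ (\sum_(0 <= i <oo) (normc (m (E i)))%:E)%E); last first.
  apply: ereal_sup_ubound; exists E => //; split.
  - move=> i; apply: measurableI; first exact: midx.
    by case: ifP => _ //; exact: measurableC.
  - apply/trivIsetP => i j _ _ ij; apply/seteqP; split=> // x [].
    rewrite /E /cell /= => -[ei Qi] [ej Qj]; move: Qi Qj; rewrite -ei -ej.
    case oi : (odd i); case oj : (odd j) => //.
    + move=> _ _; move/eqP: ij; apply.
      by rewrite -(odd_double_half i) -(odd_double_half j) oi oj -ei ej.
    + move=> _ _; move/eqP: ij; apply.
      by rewrite -(odd_double_half i) -(odd_double_half j) oi oj -ei ej.
  - apply/seteqP; split=> // x _; have [Qx|Qx] := pselect (Q (idx x) x).
      by exists (idx x).*2 => //; rewrite /E odd_double doubleK.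
    by exists (idx x).*2.+1 => //; rewrite /E /= odd_double uphalf_double.
apply: le_trans (nneseries_lim_ge N.*2 _); last first.
  by move=> i _ _; rewrite lee_fin; exact: normc_ge0.
rewrite sumEFin lee_fin big_mkord.
elim: N => [|N IH]; first by rewrite !big_ord0.
rewrite doubleS !big_ord_recr /= -addrA lerD // /E /= odd_double /=.
by rewrite uphalf_double doubleK setDE.
Qed.

(** The cell masses move, in l^1, by at most the total variation of the
    difference.  The set that realises [charge_tv_dist] depends on the cell, and
    [tv_norm_split_cells] allows for that. *)
Lemma charge_tv_cells_dist m nu nu' N :
  (forall A, measurable A -> `|fine (nu A) - fine (nu' A)| <= normc (m A)) ->
  ((\sum_(j < N) `|fine (charge_tv nu (cell j)) -
                   fine (charge_tv nu' (cell j))|)%:E <= tv_norm m)%E.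
Proof.
move=> le_m.
have mcell j : measurable (cell j) by exact: midx.
have /choice[Q QP] : forall j, exists Q : set (borel X), measurable Q /\
    `|fine (charge_tv nu (cell j)) - fine (charge_tv nu' (cell j))| <=
    normc (m (cell j `&` Q)) + normc (m (cell j `\` Q)).
  move=> j; have [Q mQ leQ] := charge_tv_dist nu nu' (mcell j).
  exists Q; split=> //; apply: le_trans leQ _.
  by apply: lerD; apply: le_m; [exact: measurableI|exact: measurableD].
apply: le_trans (@tv_norm_split_cells m Q N _); last by move=> j; case: (QP j).
by rewrite lee_fin; apply: ler_sum => j _; case: (QP j).
Qed.

Lemma charge_tv_cell_sum nu n :
  (forall j, (n <= j)%N -> fine (charge_tv nu (cell j)) = 0) ->
  charge_tv nu setT = (\sum_(j < n) fine (charge_tv nu (cell j)))%:E.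
Proof.
move=> tail0; rewrite -(eseries_zero_tail tail0).
have -> : [set: borel X] = \bigcup_j cell j.
  by apply/seteqP; split=> // x _; exists (idx x).
have mcell j : measurable (cell j) by exact: midx.
rewrite charge_tv_bigcup //.
  by apply: eq_eseriesr => j _; rewrite fineK // charge_tv_fin.
apply/trivIsetP => i j _ _ ij; apply/seteqP; split=> // x [/= xi xj].
by move: ij; rewrite -xi -xj eqxx.
Qed.

(** Using |re mu| + |im mu| rather than |mu| reduces countable additivity to the
    case of signed measures; the two are comparable up to a factor 2, which the
    normalisation of the masses absorbs. *)
Definition cell_mass mu j : R :=
  fine (charge_tv (cm_re mu) (cell j)) + fine (charge_tv (cm_im mu) (cell j)).

Lemma cell_mass_ge0 mu j : 0 <= cell_mass mu j.
Proof. by apply: addr_ge0; apply/fine_ge0/charge_tv_ge0. Qed.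

(** [mu] vanishes on all measurable subsets of a cell off its support, in
    particular on the two parts in which the Hahn decomposition cuts it. *)
Lemma cell_mass_eq0 mu (D : set X) j : measurable (D : set (borel X)) ->
  supported_in mu D -> D `&` cell j = set0 -> cell_mass mu j = 0.
Proof.
move=> mD suppD Dj0.
have m0 (B : set (borel X)) : measurable B -> B `<=` cell j ->
    cm_val mu B = 0.
  move=> mB Bj; apply: ComplexField.Normc.eq0_normc; apply/eqP.
  rewrite eq_le normc_ge0 andbT -lee_fin -[leRHS]suppD.
  apply: abs_variation_ge => //; first exact: measurableC.
  move=> x /Bj jx Dx.
  by have : (set0 : set X) x by rewrite -Dj0.
have mj : measurable (cell j) by exact: midx.
have tv0 nu : (forall B, measurable B -> B `<=` cell j -> fine (nu B) = 0) ->
    fine (charge_tv nu (cell j)) = 0.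
  move=> nu0; rewrite charge_tv_hahn // !nu0 ?subrr//.
  - by apply: measurableD => //; exact: measurable_hahn_pos.
  - by apply: measurableI => //; exact: measurable_hahn_pos.
rewrite /cell_mass !tv0 ?addr0 // => B mB /(m0 _ mB) /eqP.
  by rewrite eq_complex => /andP[_ /eqP].
by rewrite eq_complex => /andP[/eqP].
Qed.

(** The total mass of |re mu| + |im mu| dominates every sum that enters the
    supremum defining the total variation of [mu]. *)
Lemma cell_mass_sum_ge1 mu n : tv_norm (cm_val mu) = 1%E ->
  (forall j, (n <= j)%N -> cell_mass mu j = 0) ->
  1 <= \sum_(j < n) cell_mass mu j.
Proof.
move=> tv1 mass0.
have tail nu nu' : (forall j, (n <= j)%N ->
    fine (charge_tv nu (cell j)) + fine (charge_tv nu' (cell j)) = 0) ->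
  forall j, (n <= j)%N -> fine (charge_tv nu (cell j)) = 0.
  move=> H j /H /eqP; rewrite paddr_eq0; [|exact/fine_ge0/charge_tv_ge0..].
  by move=> /andP[/eqP].
rewrite -lee_fin -[1%:E]tv1 big_split EFinD /=.
rewrite -!charge_tv_cell_sum; first last.
- exact: tail mass0.
- by apply: (tail _ (cm_re mu)) => j /mass0; rewrite addrC.
apply: ge_ereal_sup => _ [E [mE tE UE] <-].
have tvE nu : charge_tv nu setT =
    (\sum_(0 <= i <oo) charge_tv nu (E i))%E.
  by rewrite -UE charge_tv_bigcup.
rewrite !tvE -nneseriesD; [|by move=> *; exact: charge_tv_ge0..].
apply: lee_nneseries => i _; first by rewrite lee_fin normc_ge0.
rewrite -[charge_tv (cm_re _) _]fineK ?charge_tv_fin//.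
rewrite -[charge_tv (cm_im _) _]fineK ?charge_tv_fin//.
by rewrite -EFinD lee_fin (le_trans (normc_le _)) // lerD // norm_charge_le_tv.
Qed.

End cell_masses.

(** * From measures to kernels *)
Section measures_to_kernels.
Context {R : realType} {X : pmetricType R}.

Lemma sum_nat_delta_le1 N i : \sum_(j < N) (i == j :> nat)%:R <= 1 :> R.
Proof.
case: (ltnP i N) => [iN|Ni].
  rewrite (bigD1 (Ordinal iN)) //= eqxx big1 ?addr0 // => j.
  by rewrite -val_eqE /= eq_sym => /negPf ->.
rewrite big1 ?ler01 // => j _.
by have /negPf -> : i != j by rewrite neq_ltn (leq_trans (ltn_ord j) Ni) orbT.
Qed.

(** Normalising two nonnegative sequences of total at least 1 at most doubles
    their l^1 distance: F/S - G/T is (F - G)/S + G (T - S)/(S T), and each of the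
    two terms contributes at most e. *)
Lemma normalized_dist (F G : nat -> R) n m e :
  (forall j, 0 <= F j) -> (forall j, 0 <= G j) ->
  (forall j, (n <= j)%N -> F j = 0) -> (forall j, (m <= j)%N -> G j = 0) ->
  1 <= \sum_(j < n) F j -> 1 <= \sum_(j < m) G j ->
  (forall N, \sum_(j < N) `|F j - G j| <= e) ->
  forall N, \sum_(j < N) `|F j / \sum_(k < n) F k - G j / \sum_(k < m) G k|
    <= 2 * e.
Proof.
move=> F0 G0 Fn Gm F1 G1 FGe N.
pose M := maxn N (maxn n m).
have NM : (N <= M)%N by rewrite leq_maxl.
have nM : (n <= M)%N by rewrite leq_max leq_maxl orbT.
have mM : (m <= M)%N by rewrite leq_max leq_maxr orbT.
rewrite -(sum_zero_tail Fn nM) -(sum_zero_tail Gm mM).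
rewrite -(sum_zero_tail Fn nM) in F1; rewrite -(sum_zero_tail Gm mM) in G1.
set S := \sum_(k < M) F k in F1 *; set T := \sum_(k < M) G k in G1 *.
have ST : `|T - S| <= e.
  apply: le_trans (FGe M); rewrite distrC -sumrB; exact: ler_norm_sum.
have e0 : 0 <= e by exact: le_trans ST.
have S0 : 0 < S by lra.
have T0 : 0 < T by lra.
apply: (@le_trans _ _ (\sum_(j < M) `|F j / S - G j / T|)).
  rewrite -!(big_mkord xpredT (fun j => `|F j / S - G j / T|)).
  by rewrite [leRHS](big_cat_nat (leq0n N) NM) /= lerDl sumr_ge0.
apply: (@le_trans _ _
    (\sum_(j < M) (`|F j - G j| / S + G j * (`|T - S| / (S * T))))).
  apply: ler_sum => j _.
  have -> : F j / S - G j / T = (F j - G j) / S + G j * ((T - S) / (S * T)).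
    by field; rewrite !gt_eqF.
  rewrite (le_trans (ler_normD _ _)) // !normrM !normfV.
  by rewrite (ger0_norm (G0 j)) (gtr0_norm S0) normrM (gtr0_norm S0) (gtr0_norm T0).
rewrite big_split /= -!mulr_suml -/T.
have -> : T * (`|T - S| / (S * T)) = `|T - S| / S by field; rewrite !gt_eqF.
rewrite -mulrDl ler_pdivrMr //.
apply: (@le_trans _ _ (2 * e)); last by rewrite ler_peMr // mulr_ge0.
by have := FGe M; lra.
Qed.

(** The measures are sampled on the net and their cell masses are normalised.
    The factor 1/8 comes from: real and imaginary part (2 * eps/8), the diagonal
    term (2 * eps/8), and the doubling in [normalized_dist]. *)
Lemma kernels_of_property_A (a : nat -> X) :
  (forall i j, i <> j -> 1 <= mdist (a i) (a j)) ->
  (forall x, exists i, mdist (a i) x < 1) ->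
  (forall x r, exists N, forall i, (N <= i)%N -> r < mdist (a i) x) ->
  property_A X -> forall r eps : R, 0 < r -> 0 < eps -> exists2 w,
    averaging_kernel a a r eps w & forall j, w j j != 0.
Proof.
move=> sepa cover lfin propA r eps r0 eps0.
have [idx [idx_near _ midx]] := exists_cells cover.
have d0 : 0 < eps / 8 by rewrite divr_gt0.
have [mu [_ _ tv1 muvar [S S0 suppS]]] := propA r (eps / 8) r0 d0.
pose F i j := cell_mass idx (mu (a i)) j + (eps / 8) * (i == j)%:R.
have mass_ge0 i j := cell_mass_ge0 idx (mu (a i)) j.
have F_ge0 i j : 0 <= F i j.
  by rewrite addr_ge0 // mulr_ge0 // ltW.
have mass_far i j : S + 1 < mdist (a i) (a j) ->
    cell_mass idx (mu (a i)) j = 0.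
  move=> far; apply: (cell_mass_eq0 midx _ (suppS (a i))).
    exact: closed_borel (@cball_closed _ _ _ _).
  apply/seteqP; split=> // x; rewrite /cball /= => -[ax xj].
  have := idx_near x; rewrite xj; have := metric_triangle (a i) x (a j).
  by rewrite (metric_sym x (a j)); lra.
have F_far i j : S + 1 < mdist (a i) (a j) -> F i j = 0.
  move=> far; rewrite /F mass_far //; case: eqVneq => [ij|_].
    by move: far; rewrite ij mdistxx; lra.
  by rewrite mulr0 addr0.
have /choice[n far_n] : forall i, exists N, forall j, (N <= j)%N ->
    S + 1 < mdist (a i) (a j).
  move=> i; have [N farN] := lfin (a i) (S + 1).
  by exists N => j /farN; rewrite metric_sym.
have Fn i j : (n i <= j)%N -> F i j = 0 by move=> /far_n /F_far.
have F1 i : 1 <= \sum_(j < n i) F i j.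
  apply: le_trans (cell_mass_sum_ge1 (n := n i) midx (tv1 (a i)) _) _.
    by move=> j /far_n /mass_far.
  by apply: ler_sum => j _; rewrite lerDl mulr_ge0 // ltW.
have sum_gt0 i : 0 < \sum_(j < n i) F i j by apply: lt_le_trans (F1 i).
have Fvar i k : mdist (a i) (a k) <= r ->
    forall N, \sum_(j < N) `|F i j - F k j| <= eps / 2.
  move=> /muvar tvle N.
  have part (nu : complex_measure X -> {charge set (borel X) -> \bar R}) :
    (forall A : set (borel X), `|fine (nu (mu (a i)) A) - fine (nu (mu (a k)) A)|
      <= normc ((cm_val (mu (a i)) - cm_val (mu (a k))) A)) ->
    \sum_(j < N) `|fine (charge_tv (nu (mu (a i))) (idx @^-1` [set j : nat])) -
      fine (charge_tv (nu (mu (a k))) (idx @^-1` [set j : nat]))| <= eps / 8.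
    move=> le_normc; rewrite -lee_fin; apply: le_trans tvle.
    by apply: charge_tv_cells_dist => // A _; exact: le_normc.
  have re := part (@cm_re R X) (fun A => normc_geRe
    ((cm_val (mu (a i)) - cm_val (mu (a k))) A)).
  have im := part (@cm_im R X) (fun A => normc_geIm
    ((cm_val (mu (a i)) - cm_val (mu (a k))) A)).
  have di := ler_wpM2l (ltW d0) (sum_nat_delta_le1 N i).
  have dk := ler_wpM2l (ltW d0) (sum_nat_delta_le1 N k).
  have := lerD (lerD re im) (lerD di dk).
  rewrite !mulr_sumr -!big_split /= => le_sum.
  apply: (@le_trans _ _ (eps / 8 + eps / 8 + (eps / 8 * 1 + eps / 8 * 1)));
    last by lra.
  apply: le_trans le_sum; apply: ler_sum => j _.
  rewrite /F /cell_mass.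
  set x1 := fine _; set x2 := fine _; set x3 := fine _; set x4 := fine _.
  set di_ := eps / 8 * _; set dk_ := eps / 8 * _.
  have -> : x1 + x2 + di_ - (x3 + x4 + dk_) =
    (x1 - x3) + (x2 - x4) + (di_ - dk_) by ring.
  apply: le_trans (ler_normD _ _) _; apply: lerD; first exact: ler_normD.
  apply: le_trans (ler_normB _ _) _.
  by rewrite !ger0_norm // mulr_ge0 // ltW.
exists (fun i j => F i j / \sum_(k < n i) F i k).
  split.
  - by move=> i j; rewrite divr_ge0 // ltW.
  - move=> i; exists (n i) => [j /Fn ->|]; first by rewrite mul0r.
    by rewrite -mulr_suml divff // gt_eqF.
  - exists (S + 1) => i j; rewrite leNgt; apply: contraNN => /F_far ->.
    by rewrite mul0r.
  - move=> i k /Fvar FikN N.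
    apply: (@le_trans _ _ (2 * (eps / 2))); last by lra.
    by apply: (normalized_dist (F_ge0 i) (F_ge0 k) (Fn i) (Fn k)).
move=> j; rewrite gt_eqF // divr_gt0 // /F eqxx mulr1.
exact: ltr_wpDl.
Qed.

End measures_to_kernels.

(** * From partitions to kernels *)
Section partitions_to_kernels.
Context {R : realType} {X : pmetricType R}.

(** Restriction of the partition to the net, for the parameter min(1/r, eps).
    Local finiteness of the supports gives finitely supported rows, and [p j] is
    a point where [rho j] is nonzero, so that [a i] and [p j] both lie in the
    support of [rho j] whenever [rho j (a i)] is nonzero. *)
Lemma kernels_of_property_A' (a : nat -> X) : property_A' X ->
  forall r eps : R, 0 < r -> 0 < eps ->
  exists p w, averaging_kernel a p r eps w.
Proof.
move=> propA' r eps r0 eps0.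
have t0 : 0 < Num.min (1 / r) eps by rewrite lt_min divr_gt0.
have [rho [[nz _ bnd] [sum1 bdiam var lfin]]] := propA' _ t0.
have [p rhop] := choice nz.
have in_spt j x : rho j x != 0 -> spt (rho j) x.
  by move=> nzx; apply: subset_closure.
have /choice[n rhon] : forall i, exists N, forall j, (N <= j)%N ->
    rho j (a i) = 0.
  move=> i; have [N ltN] := finite_nat_bounded (lfin (a i) 1 ltr01).
  exists N => j; rewrite leqNgt => /negP jN; apply: contrapT => /eqP nzj.
  by apply: jN; apply: ltN; exists (a i); split; [exact: in_spt|exact: ballxx].
have [S diamS] : exists S : R, forall j, (diam (spt (rho j)) <= S%:E)%E.
  move: bdiam; set s := ereal_sup _ => slt.
  have les j : (diam (spt (rho j)) <= s)%E.
    by apply: ereal_sup_ubound; exists j.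
  case: s slt les => [s _ les| //|_ les]; first by exists s.
  by exists 0 => j; apply: le_trans (les j) _; exact: leNye.
exists p, (fun i j => rho j (a i)); split.
- by move=> i j; have /andP[] := bnd j (a i).
- move=> i; exists (n i); first exact: rhon.
  by apply: EFin_inj; rewrite -(eseries_zero_tail (rhon i)); exact: sum1.
- exists S => i j nzij; rewrite -lee_fin; apply: le_trans (diamS j).
  apply: ereal_sup_ubound; exists (a i, p j) => //=; split; exact: in_spt.
- move=> i k ik N; rewrite -lee_fin.
  have ik' : mdist (a i) (a k) <= 1 / Num.min (1 / r) eps.
    rewrite (le_trans ik) // ler_pdivlMr // mulrC -ler_pdivlMr // ge_min.
    by rewrite lexx.
  apply: (@le_trans _ _ (Num.min (1 / r) eps)%:E); last first.
    by rewrite lee_fin ge_min lexx orbT.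
  apply: le_trans (ltW (var _ _ ik')).
  apply: le_trans (nneseries_lim_ge N _); last by [].
  by rewrite sumEFin lee_fin big_mkord.
Qed.

End partitions_to_kernels.

(** * A continuous partition of unity *)
Section partition_of_unity.
Context {R : realType} {X : pmetricType R}.

Lemma continuous_fin_sum (f : nat -> X -> R) n x :
  (forall i, continuous_at x (f i)) ->
  continuous_at x (fun y => \sum_(i < n) f i y).
Proof.
move=> cf; elim: n => [|n IH].
  under eq_fun do rewrite big_ord0.
  exact: cst_continuous.
under eq_fun do rewrite big_ord_recr /=.
exact: cvgD IH (cf n).
Qed.

Lemma near_eq_continuous (T : topologicalType) (f g : X -> T) x :
  (forall y, ball x 1 y -> f y = g y) -> continuous_at x g ->
  continuous_at x f.
Proof.
move=> fg; rewrite /continuous_at (fg x); last exact: ballxx.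
apply: cvg_trans; apply: near_eq_cvg; apply/nbhs_ballP; exists 1 => //= y /fg.
by [].
Qed.

(** Normalised tent functions of radius 1 around the net points.  Any [i] with
    [a i] at distance more than 2 from [x] is inactive on the whole ball of
    radius 1 around [x], so that near [x] only finitely many fixed indices
    matter. *)
Lemma partition_of_unity (a : nat -> X) :
  (forall x, exists i, mdist (a i) x < 1) ->
  (forall x r, exists N, forall i, (N <= i)%N -> r < mdist (a i) x) ->
  exists (phi : nat -> X -> R) (M : X -> nat),
  [/\ forall i x, 0 <= phi i x,
      forall i x, phi i x != 0 -> mdist (a i) x < 1,
      forall i, continuous (phi i),
      forall x y, ball x 1 y -> forall i, (M x <= i)%N -> phi i y = 0 &
      forall x, \sum_(i < M x) phi i x = 1].
Proof.
move=> cover lfin.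
pose psi i x := Num.max 0 (1 - mdist (a i) x).
have psi0 i x : 0 <= psi i x by rewrite le_max lexx.
have psi_gt0 i x : mdist (a i) x < 1 -> 0 < psi i x.
  by move=> aix; rewrite lt_max subr_gt0 aix orbT.
have psi_far i x : 1 <= mdist (a i) x -> psi i x = 0.
  by move=> aix; apply/max_idPl; rewrite subr_le0.
have psi_cont i : continuous (psi i).
  move=> x; apply: (@continuous_max _ X (cst 0) (fun y => 1 - mdist (a i) y)).
    exact: cst_continuous.
  exact: cvgB (cvg_cst _) (@mdist_continuous _ _ _ x).
have /choice[M farM] : forall x, exists N, forall i, (N <= i)%N ->
    2 < mdist (a i) x by move=> x; exact: lfin.
have psiM x y : ball x 1 y -> forall i, (M x <= i)%N -> psi i y = 0.
  rewrite ballEmdist /= => xy i /farM aix; apply: psi_far.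
  by have := metric_triangle (a i) y x; rewrite (metric_sym y x); lra.
pose Psi x := \sum_(i < M x) psi i x.
have Psi_gt0 x : 0 < Psi x.
  have [i aix] := cover x.
  have iM : (i < M x)%N.
    by rewrite ltnNge; apply/negP => /farM; lra.
  rewrite /Psi (bigD1 (Ordinal iM)) //=.
  by rewrite ltr_pwDl ?psi_gt0 // sumr_ge0.
have PsiE x y : ball x 1 y -> Psi y = \sum_(i < M x) psi i y.
  move=> xy; apply: (@eq_sum_zero_tail _ (psi^~ y)); last exact: psiM.
  by apply: psiM; exact: ballxx.
exists (fun i x => psi i x / Psi x), M; split.
- by move=> i x; rewrite divr_ge0 // ltW.
- move=> i x; rewrite ltNge; apply: contraNN => /psi_far ->.
  by rewrite mul0r.
- move=> i x.
  apply: (@near_eq_continuous _ _ (fun y => psi i y / \sum_(k < M x) psi k y)).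
    by move=> y /PsiE ->.
  have cPsi : continuous_at x (fun y => \sum_(k < M x) psi k y).
    by apply: continuous_fin_sum => k; exact: psi_cont.
  have Psix0 : \sum_(k < M x) psi k x != 0 by rewrite gt_eqF // Psi_gt0.
  exact: cvgM (psi_cont i x) (cvgV Psix0 cPsi).
- by move=> x y xy i /(psiM _ _ xy) ->; rewrite mul0r.
- by move=> x; rewrite -mulr_suml divff // gt_eqF // Psi_gt0.
Qed.

End partition_of_unity.

(** * Complex-valued continuous functions *)
Section complex_valued.
Context {R : realType} {X : pmetricType R}.

Lemma continuous_complexP (f : X -> R[i]^o) x : continuous_at x f <->
  continuous_at x (fun y => complex.Re (f y)) /\
  continuous_at x (fun y => complex.Im (f y)).
Proof.
split=> [cf|[cre cim]].
  have near_f (e : R) : 0 < e -> \forall y \near x, normc (f x - f y) < e.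
    move=> e0; have e0' : 0 < (e%:C : R[i]) by rewrite ltcR.
    move/cvgrPdist_lt : cf => /(_ _ e0').
    by apply: filterS => y; rewrite normc_def ltcR; case: (f x - f y).
  split; apply/cvgrPdist_lt => e /near_f; apply: filterS => y; apply: le_lt_trans.
    by have := normc_geRe (f x - f y); rewrite raddfB.
  by have := normc_geIm (f x - f y); rewrite raddfB.
apply/cvgrPdist_lt => e e0.
have [er Re0] : (complex.Re e)%:C = e /\ 0 < complex.Re e.
  by move: e0; rewrite ltcE /= => /andP[/eqP ei er]; split; case: e ei er => //= a b ->.
have Re20 : 0 < complex.Re e / 2 by rewrite divr_gt0.
move/cvgrPdist_lt : cre => /(_ _ Re20) nre.
move/cvgrPdist_lt : cim => /(_ _ Re20) nim.
apply: filterS2 nre nim => y hre him.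
rewrite -er normc_def ltcR.
have := normc_le (f x - f y); rewrite !raddfB /=.
case: (f x) hre him => a b; case: (f y) => c d /= hre him.
by move=> /le_lt_trans; apply; lra.
Qed.

Lemma continuous_borel_measurable (g : X -> R) : continuous g ->
  measurable_fun [set: borel X] (g : borel X -> R).
Proof.
move=> cg; apply: (measurability _ (RGenOInfty.measurableE R)) => //.
move=> /= _ [_ [y ->] <-]; rewrite setTI; apply: sub_sigma_algebra.
by apply: (proj1 (@continuousP _ _ g)) => //; exact: interval_open.
Qed.

End complex_valued.

(** * Finite combinations of point masses *)
Section point_masses.
Context {R : realType} {X : pmetricType R}.
Implicit Types (c : nat -> R) (p : nat -> X) (A : set (borel X)).

(** The absolute values only serve to obtain nonnegative weights without a side
    condition; the definition is used with nonnegative [c]. *)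
Definition point_masses c p n : set (borel X) -> \bar R :=
  msum (fun j => mscale (`|c j|%:nng) (@dirac _ (borel X) (p j) R)) n.

HB.instance Definition _ c p n := Measure.copy (point_masses c p n)
  (msum (fun j => mscale (`|c j|%:nng) (@dirac _ (borel X) (p j) R)) n).

Lemma point_massesE c p n A :
  point_masses c p n A = (\sum_(j < n) `|c j| * (p j \in A)%:R)%:E.
Proof.
rewrite /point_masses /msum -sumEFin; apply: eq_bigr => j _.
by rewrite /= /mscale /= diracE EFinM.
Qed.

Let point_masses_fin c p n : fin_num_fun (point_masses c p n).
Proof. by move=> A _; rewrite point_massesE. Qed.

HB.instance Definition _ c p n := @Measure_isFinite.Build _ _ _
  (point_masses c p n) (@point_masses_fin c p n).

Definition point_measure c p n : complex_measure X :=
  ComplexMeasure (charge_of_finite_measure (point_masses c p n)) czero.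

Lemma point_measureE c p n A : cm_val (point_measure c p n) A =
  (\sum_(j < n) `|c j| * (p j \in A)%:R)%:C.
Proof. by rewrite /cm_val /= /charge_of_finite_measure point_massesE. Qed.

Lemma normc_real (x : R) : normc x%:C = `|x|.
Proof. by rewrite /= expr0n addr0 sqrtr_sqr. Qed.

(** Countable additivity of [nu] bounds every sum entering the supremum. *)
Lemma le_abs_variation_measure (m : set (borel X) -> R[i])
    (nu : {measure set (borel X) -> \bar R}) A :
  (forall B, measurable B -> ((normc (m B))%:E <= nu B)%E) ->
  (abs_variation m A <= nu A)%E.
Proof.
move=> le_nu; apply: ge_ereal_sup => _ [E [mE tE <-] <-].
rewrite measure_bigcup //.
rewrite [leRHS](_ : _ = \sum_(0 <= i <oo) nu (E i))%E; last first.
  by apply: eq_eseriesl => i; rewrite in_setT.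
by apply: lee_nneseries => i _; [rewrite lee_fin normc_ge0|exact: le_nu].
Qed.

Lemma abs_variation_point_measure c p n A : measurable A ->
  abs_variation (cm_val (point_measure c p n)) A = point_masses c p n A.
Proof.
have normE B : (normc (cm_val (point_measure c p n) B))%:E =
    point_masses c p n B.
  rewrite point_measureE normc_real point_massesE ger0_norm //.
  by apply: sumr_ge0 => j _; rewrite mulr_ge0.
move=> mA; apply/eqP; rewrite eq_le le_abs_variation_measure /=.
  by rewrite -normE abs_variation_ge.
by move=> B _; rewrite normE.
Qed.

(** Removing from the space the finitely many masses outside [A] gives an open
    set, and keeping those inside [A] gives a compact set, both with the same
    mass as [A]. *)
Lemma point_measure_regular c p n : regular_measure (point_measure c p n).
Proof.
move=> A mA; set v := abs_variation _.
have vE (B : set (borel X)) : measurable B -> v B = point_masses c p n B.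
  exact: abs_variation_point_measure.
have mono (B C : set (borel X)) : measurable B -> measurable C -> B `<=` C -> (v B <= v C)%E.
  by move=> mB mC BC; rewrite !vE // le_measure // inE.
pose P : set X := [set p j | j in `I_n].
have finP (B : set X) : finite_set (P `&` B).
  by apply: finite_setIl; apply: finite_image; exact: finite_II.
have eq_on (B C : set (borel X)) : measurable B -> measurable C -> P `&` B = P `&` C -> v B = v C.
  move=> mB mC PBC; rewrite !vE // !point_massesE; congr EFin.
  apply: eq_bigr => j _; congr (_ * _%:R); congr nat_of_bool.
  have Pj : P (p j) by exists j => /=.
  apply/idP/idP; rewrite !inE => H.
    by have [] : (P `&` C) (p j) by rewrite -PBC.
  by have [] : (P `&` B) (p j) by rewrite PBC.
have clF (B : set X) : closed (P `&` B).
  by apply: compact_closed; [exact: metric_hausdorff|exact: finite_compact].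
split; apply/eqP; rewrite eq_le; apply/andP; split.
- apply: le_ereal_inf_tmp => _ [U [oU AU] <-].
  by apply: mono => //; exact: open_borel.
- apply: ereal_inf_lbound; exists (~` (P `&` ~` A)).
    split; first exact: closed_openC.
    by move=> x Ax [].
  apply: eq_on => //; first by apply: measurableC; exact: closed_borel.
  apply/seteqP; split=> x [Px]; last by move=> Ax; split=> // -[].
  by move=> H; split=> //; apply: contrapT => nAx; apply: H.
- apply: ereal_sup_ubound; exists (P `&` A).
    by split; [exact: finite_compact|move=> x []].
  by apply: eq_on => //; [exact: closed_borel|rewrite setIA setIid].
- apply: ge_ereal_sup => _ [K [cK KA] <-].
  apply: mono => //; apply: closed_borel; apply: compact_closed => //.
  exact: metric_hausdorff.
Qed.

Lemma tv_norm_point_measureB c c' p n n' (e : R) :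
  (forall j, 0 <= c j) -> (forall j, 0 <= c' j) ->
  (forall j, (n <= j)%N -> c j = 0) -> (forall j, (n' <= j)%N -> c' j = 0) ->
  (forall N, \sum_(j < N) `|c j - c' j| <= e) ->
  (tv_norm (cm_val (point_measure c p n) -
            cm_val (point_measure c' p n'))%R <= e%:E)%E.
Proof.
move=> c0 c'0 cn c'n le_e; pose M := maxn n n'.
apply: (@le_trans _ _ (point_masses (fun j => c j - c' j) p M setT)).
  apply: le_abs_variation_measure => B _.
  rewrite -[leRHS]/(point_masses (fun j => c j - c' j) p M B).
  rewrite point_massesE lee_fin.
  have tail n0 (d : nat -> R) : (forall j, (n0 <= j)%N -> d j = 0) ->
      (n0 <= M)%N -> \sum_(j < n0) `|d j| * (p j \in B)%:R =
      \sum_(j < M) `|d j| * (p j \in B)%:R.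
    move=> dn nM; apply/esym.
    apply: (@sum_zero_tail _ (fun j => `|d j| * (p j \in B)%:R)) => // j /dn ->.
    by rewrite normr0 mul0r.
  rewrite -[X in normc X]/(cm_val (point_measure c p n) B -
    cm_val (point_measure c' p n') B) (point_measureE c) (point_measureE c') -rmorphB normc_real.
  rewrite (tail n c) ?leq_maxl // (tail n' c') ?leq_maxr // -sumrB.
  apply: le_trans (ler_norm_sum _ _ _) _; apply: ler_sum => j _.
  by rewrite (ger0_norm (c0 j)) (ger0_norm (c'0 j)) -mulrBl normrM normr_nat.
rewrite point_massesE lee_fin; apply: le_trans (le_e M).
by apply: ler_sum => j _; rewrite in_setT mulr1.
Qed.

(** The integral of a signed function is split into positive and negative parts,
    where additivity in the measure is available. *)
Lemma integral_point_masses c p n (g : X -> R) :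
  measurable_fun [set: borel X] (g : borel X -> R) ->
  (\int[point_masses c p n]_x (g x)%:E = (\sum_(j < n) `|c j| * g (p j))%:E)%E.
Proof.
move=> mg; have mgE : measurable_fun [set: borel X] 
    ((fun x => (g x)%:E) : borel X -> \bar R).
  exact/measurable_EFinP.
have ge0 (h : borel X -> \bar R) : measurable_fun setT h ->
    (forall x, 0 <= h x)%E -> (\int[point_masses c p n]_x h x =
    \sum_(j < n) `|c j|%:E * h (p j))%E.
  move=> mh h0; rewrite ge0_integral_measure_sum //; apply: eq_bigr => j _.
  by rewrite ge0_integral_mscale // integral_dirac // diracT mul1e.
rewrite integralE !ge0 //; [|exact: measurable_funeneg|exact: measurable_funepos].
rewrite (eq_bigr (fun j : 'I_n => (`|c j| * Num.max (g (p j)) 0)%:E)); last first.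
  by move=> j _; rewrite funeposE -EFin_max EFinM.
rewrite [X in (_ - X)%E](eq_bigr
    (fun j : 'I_n => (`|c j| * Num.max (- g (p j)) 0)%:E)); last first.
  by move=> j _; rewrite funenegE -EFinN -EFin_max EFinM.
rewrite !sumEFin -EFinB -sumrB; congr EFin; apply: eq_bigr => j _.
rewrite -mulrBr; congr (_ * _); have [g0|g0] := ltrP (g (p j)) 0.
  by rewrite max_l ?sub0r ?opprK // oppr_ge0 ltW.
by rewrite max_r ?subr0 // oppr_le0.
Qed.

(** For a nonnegative charge the negative part of any Hahn decomposition is
    null, whatever choice was made in the definition of the integral. *)
Lemma charge_integral_measure (mu : {finite_measure set (borel X) -> \bar R})
    (nu : {charge set (borel X) -> \bar R}) (g : X -> R) :
  (forall A, measurable A -> nu A = mu A) ->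
  charge_integral nu g = \int[mu]_x g x.
Proof.
move=> nu_mu; rewrite /charge_integral; case: cid => -[P N] /= PN.
have [[mP _] [mN negN] PNT PN0] := PN.
have muN0 A : measurable A -> A `<=` N -> mu A = 0%E.
  move=> mA AN; apply/eqP; rewrite eq_le measure_ge0 andbT -nu_mu //.
  exact: negN.
have negE A : measurable A -> jordan_neg PN A = 0%E.
  move=> mA; have mAN : measurable (A `&` N) by exact: measurableI.
  rewrite jordan_negE cjordan_negE /crestr0 mem_set // /crestr.
  by rewrite nu_mu // muN0 ?oppe0 //; exact: subIsetr.
have posE A : measurable A -> jordan_pos PN A = mu A.
  move=> mA; have := jordan_decomp PN mA.
  rewrite -[cadd _ _ A]/(jordan_pos PN A + (-1)%:E * jordan_neg PN A)%E.
  by rewrite negE // mule0 adde0 -nu_mu.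
rewrite /Rintegral (eq_measure_integral mu) => [|A mA _]; last exact: posE.
rewrite [X in _ - fine X](eq_measure_integral mzero) => [|A mA _];
  last exact: negE.
by rewrite integral_measure_zero subr0.
Qed.

Lemma cm_integral_point_measure c p n (f : X -> R[i]) :
  (forall j, 0 <= c j) ->
  measurable_fun [set: borel X] ((fun x => complex.Re (f x)) : borel X -> R) ->
  measurable_fun [set: borel X] ((fun x => complex.Im (f x)) : borel X -> R) ->
  cm_integral (point_measure c p n) f =
  (\sum_(j < n) c j * complex.Re (f (p j))) +i*
  (\sum_(j < n) c j * complex.Im (f (p j))).
Proof.
move=> c0 mre mim; rewrite /cm_integral /=.
have zero (g : X -> R) :
    charge_integral (czero : {charge set (borel X) -> \bar R}) g = 0.
  have pm0 A : point_masses c p 0 A = 0%E by rewrite point_massesE big_ord0.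
  rewrite (@charge_integral_measure (point_masses c p 0)); last first.
    by move=> A _; exact/esym/pm0.
  rewrite /Rintegral (eq_measure_integral mzero); last by move=> A _ _; exact: pm0.
  by rewrite integral_measure_zero.
rewrite !zero subr0 addr0 !(@charge_integral_measure (point_masses c p n)) //.
rewrite /Rintegral !integral_point_masses //=.
congr (_ +i* _).
  by apply: eq_bigr => j _; rewrite ger0_norm.
by apply: eq_bigr => j _; rewrite ger0_norm.
Qed.

End point_masses.

(** * From kernels to measures *)
Section kernels_to_measures.
Context {R : realType} {X : pmetricType R}.

(** Since [u] and [v] have total 1, the difference of the two averages is
    the average, with weights [u i * v k], of the differences [w i - w k]. *)
Lemma convex_sums_dist (I J : nat) (u v : nat -> R) (w : nat -> nat -> R)
    (N : nat) (e : R) :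
  (forall i, 0 <= u i) -> (forall k, 0 <= v k) ->
  \sum_(i < I) u i = 1 -> \sum_(k < J) v k = 1 ->
  (forall i k, u i != 0 -> v k != 0 ->
    \sum_(j < N) `|w i j - w k j| <= e) ->
  \sum_(j < N) `|\sum_(i < I) u i * w i j - \sum_(k < J) v k * w k j| <= e.
Proof.
move=> u0 v0 u1 v1 le_e.
have diffE j : \sum_(i < I) u i * w i j - \sum_(k < J) v k * w k j =
    \sum_(i < I) \sum_(k < J) u i * v k * (w i j - w k j).
  under [RHS]eq_bigr => i _.
    under eq_bigr => k _ do rewrite mulrBr -mulrA (mulrCA (u i)) -[X in _ - X]mulrA.
    rewrite sumrB -mulr_suml v1 mul1r -mulr_sumr.
    over.
  by rewrite sumrB -mulr_suml u1 mul1r.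
apply: (@le_trans _ _ (\sum_(j < N) \sum_(i < I) \sum_(k < J)
    u i * v k * `|w i j - w k j|)).
  apply: ler_sum => j _; rewrite diffE.
  apply: le_trans (ler_norm_sum _ _ _) _; apply: ler_sum => i _.
  apply: le_trans (ler_norm_sum _ _ _) _; apply: ler_sum => k _.
  by rewrite normrM ger0_norm // mulr_ge0.
apply: (@le_trans _ _ (\sum_(i < I) \sum_(k < J) u i * v k * e)).
  rewrite exchange_big /=; apply: ler_sum => i _.
  rewrite exchange_big /=; apply: ler_sum => k _.
  rewrite -mulr_sumr; have [->|ui] := eqVneq (u i) 0; first by rewrite !mul0r.
  have [->|vk] := eqVneq (v k) 0; first by rewrite mulr0 !mul0r.
  by rewrite ler_wpM2l ?mulr_ge0 // le_e.
under eq_bigr => i _ do rewrite -mulr_suml -mulr_sumr v1 mulr1.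
by rewrite -mulr_suml u1 mul1r.
Qed.

(** [sigma j x], the mass of [mu x] at [p j], is the average of the [w i j] with
    the weights of the partition of unity.  On the unit ball around [x] only
    the indices [i < M x] are active, hence only the masses [j < L x].  The
    kernel is taken at scale [r + 2]: active net points are within 1 of [x]. *)
Lemma property_A_of_kernels (a : nat -> X) :
  (forall x, exists i, mdist (a i) x < 1) ->
  (forall x r, exists N, forall i, (N <= i)%N -> r < mdist (a i) x) ->
  (forall r eps : R, 0 < r -> 0 < eps ->
    exists p w, averaging_kernel a p r eps w) ->
  property_A X.
Proof.
move=> cover lfin kernels r eps r0 eps0.
have [phi [M [phi0 phi_near phi_cont phi_far phi1]]] :=
  partition_of_unity cover lfin.
have r20 : 0 < r + 2 by lra.
have [p [w [w0 wsum [S wS] wvar]]] := kernels _ _ r20 eps0.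
have /choice[n nP] : forall i, exists n, (forall j, (n <= j)%N -> w i j = 0) /\
    \sum_(j < n) w i j = 1.
  by move=> i; have [n wn w1] := wsum i; exists n.
pose L x := \max_(i < M x) n i.
have nL x (i : 'I_(M x)) : (n i <= L x)%N.
  exact: (leq_bigmax (F := fun i : 'I_(M x) => n i)).
pose sigma j x := \sum_(i < M x) phi i x * w i j.
have sigma0 j x : 0 <= sigma j x.
  by apply: sumr_ge0 => i _; rewrite mulr_ge0.
have sigmaE x y : ball x 1 y ->
    forall j, sigma j y = \sum_(i < M x) phi i y * w i j.
  move=> xy j; apply: (@eq_sum_zero_tail _ (fun i => phi i y * w i j)) => i.
    by move=> /(phi_far y y) ->; [rewrite mul0r|exact: ballxx].
  by move=> /(phi_far x y xy) ->; rewrite mul0r.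
have sigma_far x y : ball x 1 y -> forall j, (L x <= j)%N -> sigma j y = 0.
  move=> xy j Lj; rewrite (sigmaE x y xy) big1 // => i _.
  have [wn _] := nP i; rewrite wn ?mulr0 //.
  exact: leq_trans (nL x i) Lj.
have sigma_tail x j : (L x <= j)%N -> sigma j x = 0.
  by apply: sigma_far; exact: ballxx.
have sigma_sum x : \sum_(j < L x) sigma j x = 1.
  rewrite exchange_big /= -[RHS](phi1 x); apply: eq_bigr => i _.
  have [wn w1] := nP i; rewrite -mulr_sumr (sum_zero_tail wn (nL x i)).
  by rewrite w1 mulr1.
have sigma_var x y : mdist x y <= r ->
    forall N, \sum_(j < N) `|sigma j x - sigma j y| <= eps.
  move=> xy N; apply: (convex_sums_dist (u := phi^~ x) (v := phi^~ y)) => // i k /phi_near aix /phi_near aky.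
  apply: wvar; have := metric_triangle (a i) x (a k).
  have := metric_triangle x y (a k); rewrite (metric_sym y (a k)).
  by move: aix aky; lra.
have sigma_near j x : sigma j x != 0 -> mdist x (p j) <= `|S| + 1.
  apply: contraTT; rewrite -ltNge => far; rewrite negbK; apply/eqP.
  apply: big1 => i _; apply/eqP; rewrite mulf_eq0.
  apply/orP; have [_|/phi_near aix] := eqVneq (phi i x) 0; first by left.
  right; apply: contraTT far => /wS aip; rewrite -leNgt.
  have := metric_triangle x (a i) (p j); rewrite (metric_sym x (a i)).
  by have := ler_norm S; lra.
have sigma_cont j : continuous (sigma j).
  move=> x; apply: (near_eq_continuous
    (g := fun y => \sum_(i < M x) phi i y * w i j)).
    by move=> y /sigmaE ->.
  apply: (@continuous_fin_sum _ _ (fun i y => phi i y * w i j)) => i.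
  exact: cvgM (phi_cont i x) (cvg_cst _).
exists (fun x => point_measure (fun j => sigma j x) p (L x)); split.
- by move=> x; exact: point_measure_regular.
- move=> f [cf _].
  have cre : continuous (fun x => complex.Re (f x)).
    by move=> x; have [] := (continuous_complexP f x).1 (cf x).
  have cim : continuous (fun x => complex.Im (f x)).
    by move=> x; have [] := (continuous_complexP f x).1 (cf x).
  have -> : (fun x => cm_integral (point_measure (fun j => sigma j x) p (L x)) f)
      = (fun x => (\sum_(j < L x) sigma j x * complex.Re (f (p j))) +i*
                  (\sum_(j < L x) sigma j x * complex.Im (f (p j)))).
    apply/funext => x; apply: cm_integral_point_measure => //.
    - exact: continuous_borel_measurable.
    - exact: continuous_borel_measurable.
  have csum (b : nat -> R) :
      continuous (fun x => \sum_(j < L x) sigma j x * b j).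
    move=> x; apply: (near_eq_continuous
      (g := fun y => \sum_(j < L x) sigma j y * b j)).
      move=> y xy; apply: (@eq_sum_zero_tail _ (fun j => sigma j y * b j)) => j.
        by move=> /sigma_tail ->; rewrite mul0r.
      by move=> /(sigma_far x y xy) ->; rewrite mul0r.
    apply: (@continuous_fin_sum _ _ (fun j y => sigma j y * b j)) => j.
    exact: cvgM (sigma_cont j x) (cvg_cst _).
  move=> x; apply/continuous_complexP; split=> /=.
    exact: (csum (fun j => complex.Re (f (p j)))).
  exact: (csum (fun j => complex.Im (f (p j)))).
- move=> x; rewrite /tv_norm abs_variation_point_measure // point_massesE.
  congr EFin; rewrite -[RHS](sigma_sum x); apply: eq_bigr => j _.
  by rewrite in_setT mulr1 ger0_norm.
- move=> x y /sigma_var xy; apply: tv_norm_point_measureB => //.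
  + exact: sigma_tail.
  + exact: sigma_tail.
exists (`|S| + 1); first by rewrite ltr_wpDl.
move=> x; rewrite /supported_in abs_variation_point_measure; last first.
  by apply: measurableC; exact: closed_borel (@cball_closed _ _ _ _).
rewrite point_massesE big1 // => j _.
have [->|/sigma_near near] := eqVneq (sigma j x) 0; first by rewrite normr0 mul0r.
by rewrite memNset ?mulr0 //; apply.
Qed.

End kernels_to_measures.

Theorem theorem2p4 (R : realType) (X : pmetricType R) :
  unbounded_space X -> proper_space X -> bounded_geometry X ->
  property_A X <-> property_A' X.
Proof.
move=> unbX properX _.
have [a [sepa cover lfin]] := exists_net properX unbX.
split=> [propA|propA'].
  apply: (property_A'_of_kernels sepa cover lfin).
  exact: kernels_of_property_A sepa cover lfin propA.
apply: (property_A_of_kernels cover lfin).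
exact: kernels_of_property_A' propA'.
Qed.
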